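(* Let $X$ be a nontrivial mm-space of finite diameter such that $d_X(x,y)\ge\delta$ for any different $x,y\in X$, where $\delta$ is a positive constant. Then, for any $0<\kappa<1$ and $1<p<+\infty$, we have $$\liminf_{n\to\infty} \frac{\operatorname{ObsDiam}(X_p^n;-\kappa)}{n^{\frac{1}{2p}}} \ge \left(\frac{2\,\Phi^{-1}(\kappa)\sqrt{V_p(X)}}{p}\right)^{\frac1p}\left(\frac{\delta}{\operatorname{diam}(X)}\right)^{1-\frac1p},$$ where $$\Phi(r):=\int_r^\infty \frac{1}{\sqrt{2\pi}}e^{-\frac{t^2}{2}}\,dt,\qquad V_p(X):=\sup_{x\in X} V(d_X(x,\cdot)^p),$$ and $V(f)$ is the variance of a function $f:X\to\mathbb{R}$, i.e., $V(f):=\int_X\left(f-\int_X f\,d\mu_X\right)^2 d\mu_X$.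
   Context: An mm-space is a space $X$ equipped with a complete separable metric $d_X$ and a Borel probability measure $\mu_X$ on $X$. It is nontrivial if $\mu_X$ is not a Dirac measure, i.e. the support of $\mu_X$ has at least two points. $l_p$-product: for $1 \le p < +\infty$ and $n\ge 1$, $X_p^n := (X^n, d_{X_p^n}, \mu_X^{\otimes n})$, where $d_{X_p^n}(x,y) := \left(\sum_{i=1}^n d_X(x_i,y_i)^p\right)^{1/p}$ for $x=(x_1,\dots,x_n), y=(y_1,\dots,y_n)\in X^n$ and $\mu_X^{\otimes n}$ is the product measure. Partial diameter: for an mm-space $X$ and a real number $\alpha$, $\operatorname{diam}(X;\alpha)=\operatorname{diam}(\mu_X;\alpha)$ is the infimum of $\operatorname{diam}(A)$ over all Borel subsets $A\subset X$ with $\mu_X(A)\ge \alpha$, where $\operatorname{diam}(A)$ is the diameter of $A$. Observable diameter: for $\kappa>0$, $\operatorname{ObsDiam}(X;-\kappa)$ is the supremum of $\operatorname{diam}(f_*\mu_X;1-\kappa)$ over all $1$-Lipschitz functions $f:X\to\mathbb{R}$, where $f_*\mu_X$ is the push-forward measure on $\mathbb{R}$ (with its usual metric). $\Phi^{-1}:(0,1)\to\mathbb{R}$ denotes the inverse function of the strictly decreasing bijection $\Phi:\mathbb{R}\to(0,1)$.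
   Formalization: For 1/2 < κ < 1 the number Φ^{-1}(κ) is negative and its real power 1/p is undefined; the base 2Φ^{-1}(κ)√V_p(X)/p is replaced by its positive part, so the lower bound is 0 there; nothing changes for κ ≤ 1/2. *)

(* Defs.v *)
From HB Require Import structures.
From mathcomp Require Import all_boot all_order all_algebra.
From mathcomp Require Import all_classical all_reals all_analysis.

Set Implicit Arguments.
Unset Strict Implicit.
Unset Printing Implicit Defensive.

Import Order.TTheory GRing.Theory Num.Theory.
Import numFieldNormedType.Exports.

Local Open Scope classical_set_scope.
Local Open Scope ring_scope.

#[short(type="completeMetricType")]
HB.structure Definition CompleteMetric (K : numDomainType) :=
  {T of Metric K T & Complete T}.

Definition separable (T : topologicalType) : Prop :=
  exists2 D : set T, countable D & dense D.

Notation borel T := (g_sigma_algebraType (@open T)).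

Record mmSpace (R : realType) := MMSpace {
  mm_carrier :> completeMetricType R;
  mm_separable : separable mm_carrier;
  mm_measure : probability (borel mm_carrier) R }.

Definition mm_dist (R : realType) (X : mmSpace R) : borel X -> borel X -> R :=
  @mdist R X.

Definition nontrivial (R : realType) (X : mmSpace R) : Prop :=
  ~ exists x : borel X, forall A : set (borel X),
      measurable A -> mm_measure X A = \d_x A.

(* The maximum with 0 gives the empty set diameter 0. *)
Definition diam (R : realType) (T : Type) (d : T -> T -> R) (A : set T) :
    \bar R :=
  maxe 0%E (ereal_sup [set (d xy.1 xy.2)%:E | xy in A `*` A]).

Definition partial_diam (R : realType) (disp : measure_display)
    (T : measurableType disp) (d : T -> T -> R) (mu : set T -> \bar R)
    (alpha : R) : \bar R :=
  ereal_inf [set diam d A | A in [set A | measurable A /\ (alpha%:E <= mu A)%E]].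

Definition lipschitz1 (R : realType) (T : Type) (d : T -> T -> R)
    (f : T -> R) : Prop :=
  forall x y, `|f x - f y| <= d x y.

(* No measurability of f is asked for: a 1-Lipschitz function on an mm-space is
   Borel measurable.  The space is given by its distance and its measure, so
   that the definition applies to a product.  The parameter kappa stands for the
   observable diameter at -kappa. *)
Definition obs_diam (R : realType) (disp : measure_display)
    (T : measurableType disp) (d : T -> T -> R) (mu : set T -> \bar R)
    (kappa : R) : \bar R :=
  ereal_sup
    [set partial_diam (T := measurableTypeR R) (fun a b => `|a - b|)
           (pushforward mu f) (1 - kappa)
    | f in lipschitz1 d].

Definition lp_dist (R : realType) (T : Type) (d : T -> T -> R) (p : R) (n : nat)
    (x y : n.-tuple T) : R :=
  (\sum_(i < n) d (tnth x i) (tnth y i) `^ p) `^ p^-1.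

Section product_measure.
Context {disp : measure_display} {T : measurableType disp} {R : realType}.

Definition tuple_cons (n : nat) (xt : T * n.-tuple T) : n.+1.-tuple T :=
  [the n.+1.-tuple T of xt.1 :: xt.2].

Lemma measurable_tuple_cons (n : nat) :
  measurable_fun [set: T * n.-tuple T] (@tuple_cons n).
Proof. by apply: measurable_cons. Qed.

HB.instance Definition _ (n : nat) :=
  isMeasurableFun.Build _ _ _ _ (@tuple_cons n) (@measurable_tuple_cons n).

Fixpoint tensor_power (P : probability T R) (n : nat) :
    probability (n.-tuple T) R :=
  if n is m.+1 then
    distribution (P \x tensor_power P m)%E (@tuple_cons m)
  else \d_([tuple]).

Lemma measurable_box (n : nat) (A : 'I_n -> set T) :
  (forall i, measurable (A i)) ->
  measurable [set t : n.-tuple T | forall i, A i (tnth t i)].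
Proof.
move=> mA; rewrite [X in measurable X](_ : _ =
    \bigcap_(i in [set: 'I_n]) ((@tnth n T)^~ i @^-1` A i)); last first.
  by apply/seteqP; split=> [t At i _|t At i]; [exact: At|exact: (At i I)].
apply: fin_bigcap_measurable => [|i _]; first exact: finite_finset.
rewrite -[X in measurable X]setTI.
exact: (@measurable_tnth _ T n i measurableT _ (mA i)).
Qed.

Lemma tensor_power_box (P : probability T R) (n : nat) (A : 'I_n -> set T) :
  (forall i, measurable (A i)) ->
  tensor_power P n [set t | forall i, A i (tnth t i)] =
  (\prod_(i < n) P (A i))%E.
Proof.
elim: n A => [|n IHn] A mA.
  by rewrite big_ord0 /= diracE mem_set// => -[].
rewrite big_ord_recl -IHn//= /distribution /pushforward.
rewrite -product_measure1E//;
  last exact: (@measurable_box n (fun i => A (lift ord0 i))).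
congr (product_measure1 _ _ _).
apply/seteqP; split=> [[x t] /= At|[x t] /= [Ax At] i].
  by split=> [|i]; [have := At ord0|have := At (lift ord0 i); rewrite tnthS].
by case: (unliftP ord0 i) => [j|] ->; rewrite ?tnthS.
Qed.

End product_measure.

(* The sigma-algebra of n.-tuple (borel X) is generated by the coordinates; as X
   is separable, it is the Borel sigma-algebra of the l_p-distance. *)
Definition obs_diam_power (R : realType) (X : mmSpace R) (p : R) (n : nat)
    (kappa : R) : \bar R :=
  obs_diam (lp_dist (@mm_dist R X) p (n := n)) (tensor_power (mm_measure X) n)
    kappa.

Definition mm_diam (R : realType) (X : mmSpace R) : \bar R :=
  diam (@mm_dist R X) setT.

Definition Phi (R : realType) (r : R) : R :=
  \int[lebesgue_measure]_(t in `[r, +oo[)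
    ((Num.sqrt (2 * pi))^-1 * expR (- (t ^+ 2 / 2))).

(* Phi is a strictly decreasing bijection onto ]0, 1[, so for k in ]0, 1[ the set
   below is a singleton. *)
Definition Phi_inv (R : realType) (k : R) : R := xget 0 [set r | Phi r = k].

Definition V_sup (R : realType) (X : mmSpace R) (p : R) : \bar R :=
  ereal_sup
    [set 'V_(mm_measure X)[fun y => mm_dist x y `^ p] | x in [set: borel X]].

(* Main.v *)
(* Fix a point x and put S(t) = \sum_i d(x, t_i)^p.  Since distances between
   different points lie in [delta, diam X], S is Lipschitz for the p-th power of
   the l_p-distance, with constant p (diam X / delta)^(p - 1), so the p-th root
   of the positive part of an affine function of S is 1-Lipschitz.  By the
   central limit theorem, S deviates from its mean by s sqrt(n V) on either side
   with probability > kappa as soon as s < Phi^-1(kappa); every set of measure at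
   least 1 - kappa meets both events, and choosing the positive part to vanish
   exactly on the lower one gives the bound.

   The central limit theorem is proved by Lindeberg's exchange argument with
   Phi(_ / rho) as test function: its images under the heat flow are again of
   this form, so no Gaussian variable is ever needed. *)
Require Import Defs.
From HB Require Import structures.
From mathcomp Require Import all_boot all_order all_algebra.
From mathcomp Require Import all_classical all_reals all_analysis.
From mathcomp Require Import measurable_realfun.
From mathcomp Require Import ring lra.

Set Implicit Arguments.
Unset Strict Implicit.
Unset Printing Implicit Defensive.

Import Order.TTheory GRing.Theory Num.Theory.
Import numFieldNormedType.Exports.

Local Open Scope classical_set_scope.
Local Open Scope ring_scope.

(** * The Gaussian tail function and the heat flow *)

(** The integrand of [Phi], kept explicit so that its derivatives can be computed; [gauss_pdfE]
    identifies it with [normal_pdf 0 1]. *)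
Definition gauss_pdf {R : realType} (t : R) : R :=
  (Num.sqrt (2 * pi))^-1 * expR (- (t ^+ 2 / 2)).

Lemma gauss_pdfE {R : realType} (t : R) : gauss_pdf t = normal_pdf 0 1 t.
Proof.
rewrite normal_pdfE ?oner_eq0// /normal_peak /normal_fun /gauss_pdf.
by congr (_^-1 * expR _); rewrite ?subr0 ?expr1n ?mulNr// mul1r mulr_natl.
Qed.

Lemma PhiE {R : realType} (r : R) : Phi r = fine (normal_prob 0 1 `[r, +oo[).
Proof.
rewrite /Phi /Rintegral /normal_prob; congr fine.
by apply: eq_integral => t _; rewrite -gauss_pdfE.
Qed.

Lemma Phi_ge0 {R : realType} (r : R) : 0 <= Phi r.
Proof. by rewrite PhiE fine_ge0. Qed.

Lemma Phi_le1 {R : realType} (r : R) : Phi r <= 1.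
Proof.
rewrite PhiE -lee_fin fineK; last exact: fin_num_measure.
exact: probability_le1.
Qed.

Lemma Phi_small {R : realType} (e : R) : 0 < e -> exists z, Phi z < e.
Proof.
move=> e0; pose P : probability (measurableTypeR R) R := normal_prob 0 1.
pose X : {RV P >-> R} := HB.pack idfun
  (isMeasurableFun.Build _ _ (measurableTypeR R) R idfun
    (@measurable_id _ _ setT)).
have /fine_cvgP[_ /cvgrPdist_lt/(_ _ e0)] := cvg_ccdfy0 X.
move=> [M [_ /(_ (M + 1))]]; rewrite ltrDl => /(_ ltr01).
rewrite /= sub0r normrN ger0_norm ?fine_ge0// => PM.
(* The bound at [M + 1] concerns an open half-line and [Phi] a closed one; the extra 1 absorbs the
   difference. *)
exists (M + 2); apply: le_lt_trans PM; rewrite PhiE.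
have : (P `[(M + 2)%R, +oo[%classic <= P `](M + 1)%R, +oo[%classic)%E.
  apply: le_measure; rewrite ?inE// => t /=; rewrite !in_itv/= !andbT.
  by apply: lt_le_trans; rewrite ltrD2l ltr1n.
by apply: fine_le; exact: fin_num_measure.
Qed.

(** [Phi] is 1 minus the distribution function [F], to which the fundamental theorem of calculus
    applies. *)
Lemma is_derive_Phi {R : realType} (x : R) :
  is_derive x 1 (@Phi R) (- gauss_pdf x).
Proof.
pose F y := \int[lebesgue_measure]_(t in `]-oo, y]) (@normal_pdf R 0 1 t).
have Ig A : measurable A -> (@lebesgue_measure R).-integrable A
    (EFin \o normal_pdf 0 1).
  by move=> mA; apply: integrableS (integrable_normal_pdf 0 1).
have PhiF y : Phi y = 1 - F y.
  transitivity (\int[lebesgue_measure]_(t in `]y, +oo[) (@normal_pdf R 0 1 t)).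
    rewrite Rintegral_itv_obnd_cbnd; last exact: Ig.
    by apply: eq_Rintegral => t _; rewrite -gauss_pdfE.
  rewrite -(@Rintegral_itvB _ _ -oo%O)//; last exact: Ig.
  congr (_ - _); rewrite /Rintegral set_itvNyy integral_normal_pdf//.
have xx1 : x < x + 1 by rewrite ltrDl.
have [||dF F'] := @continuous_FTC1 R (normal_pdf 0 1) -oo%O x _ xx1
  (Ig _ (measurable_itv _)); first by rewrite ltNyr.
  exact: continuous_normal_pdf.
have dF1 : is_derive x 1 F (gauss_pdf x).
  by rewrite gauss_pdfE; apply: DeriveDef; [exact: dF|rewrite -derive1E].
rewrite (_ : @Phi R = cst 1 - F); last by apply/funext => y; rewrite PhiF.
by apply: is_derive_eq (is_deriveB (is_derive_cst _ _ _) dF1) _; rewrite sub0r.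
Qed.

(** * Taylor estimates on an interval *)

(** The endpoints may come in either order; the two distance bounds place [c] between them. The
    interval [D] allows for functions such as [z / x], which are differentiated only for
    [x >= 1]. *)
Lemma MVT_interval {R : realType} (D : set R) (f df : R -> R) (a b : R) :
  is_interval D -> D a -> D b -> (forall x, D x -> is_derive x 1 f (df x)) ->
  exists c, [/\ D c, `|c - a| <= `|b - a|, `|c - b| <= `|b - a| &
    f b - f a = df c * (b - a)].
Proof.
move=> ID Da Db Df.
wlog ab : a b Da Db / a <= b => [hw|].
  have [/hw//|/ltW ba] := leP a b; first exact.
  have [c [Dc cb ca e]] := hw _ _ Db Da ba.
  by exists c; split; rewrite ?[`|b - a|]distrC// -opprB e -mulrN opprB.
have Dab x : x \in `[a, b] -> D x.
  by rewrite in_itv/= => xab; exact: ID Da Db _ xab.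
have [||c cab fab] := @MVT_segment _ f df a b ab.
- by move=> x xab; apply/Df/Dab/subset_itv_oo_cc.
- apply: continuous_in_subspaceT => x /[!inE] /Dab/Df dfx.
  exact/differentiable_continuous/derivable1_diffP.
exists c; split=> //; first exact: Dab.
- move: cab; rewrite in_itv/= => /andP[ac cb].
  by rewrite !ger0_norm ?subr_ge0// lerD2r.
- move: cab; rewrite in_itv/= => /andP[ac cb].
  by rewrite distrC !ger0_norm ?subr_ge0// lerB.
Qed.

(** Two uses of the mean value theorem, for [f] and then for [df]; the factor 1/2 of the sharp
    remainder is given up. *)
Lemma taylor1_le {R : realType} (D : set R) (f df ddf : R -> R) (M a b : R) :
  is_interval D -> D a -> D b ->
  (forall x, D x -> is_derive x 1 f (df x)) ->
  (forall x, D x -> is_derive x 1 df (ddf x)) ->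
  (forall x, D x -> `|ddf x| <= M) ->
  `|f b - f a - df a * (b - a)| <= M * `|b - a| ^+ 2.
Proof.
move=> ID Da Db Df Ddf ddfM.
have [c [Dc ca _ ->]] := MVT_interval ID Da Db Df.
have [d [Dd _ _ cE]] := MVT_interval ID Da Dc Ddf.
rewrite -mulrBl cE !normrM expr2 mulrA ler_wpM2r// ler_pM//.
exact: ddfM.
Qed.

Lemma taylor2_le {R : realType} (D : set R) (f df ddf dddf : R -> R) (M a b : R) :
  is_interval D -> D a -> D b ->
  (forall x, D x -> is_derive x 1 f (df x)) ->
  (forall x, D x -> is_derive x 1 df (ddf x)) ->
  (forall x, D x -> is_derive x 1 ddf (dddf x)) ->
  (forall x, D x -> `|dddf x| <= M) ->
  `|f b - f a - df a * (b - a) - ddf a / 2 * (b - a) ^+ 2| <= M * `|b - a| ^+ 3.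
Proof.
move=> ID Da Db Df Ddf Dddf dddfM.
(* The derivative of [h] is the first-order remainder of [df], which [taylor1_le] bounds. *)
pose h x := f x - df a * x - ddf a / 2 * (x - a) ^+ 2.
have Dh x : D x -> is_derive x 1 h (df x - df a - ddf a * (x - a)).
  move=> Dx; have Dfx := Df _ Dx.
  rewrite /h; apply: is_derive_eq.
  by rewrite /GRing.scale/=; field.
have [c [Dc ca _ hE]] := MVT_interval ID Da Db Dh.
have -> : f b - f a - df a * (b - a) - ddf a / 2 * (b - a) ^+ 2 = h b - h a.
  by rewrite /h subrr expr0n/= mulr0 subr0; ring.
rewrite hE normrM exprSr mulrA ler_wpM2r//.
apply: le_trans (taylor1_le ID Da Dc Ddf Dddf dddfM) _.
rewrite ler_wpM2l//; first exact: le_trans (dddfM _ Da).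
by rewrite lerXn2r ?nnegrE.
Qed.

(** * Gaussian bounds and one step of the heat flow *)

Lemma gauss_pdf_ge0 {R : realType} (z : R) : 0 <= gauss_pdf z.
Proof. by rewrite mulr_ge0 ?expR_ge0// invr_ge0 sqrtr_ge0. Qed.

Lemma gauss_pdf_gt0 {R : realType} (z : R) : 0 < gauss_pdf z.
Proof. by rewrite mulr_gt0 ?expR_gt0// invr_gt0 sqrtr_gt0 mulr_gt0 ?pi_gt0. Qed.

Lemma is_derive_gauss_pdf {R : realType} (z : R) :
  is_derive z 1 (@gauss_pdf R) (- z * gauss_pdf z).
Proof.
have D1 : is_derive z 1 (fun t : R => - (t ^+ 2 / 2)) (- z).
  by apply: is_derive_eq; rewrite /GRing.scale/=; field.
have D2 := is_derive1_comp (is_derive_expR _) D1.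
rewrite (_ : @gauss_pdf R = (Num.sqrt (2 * pi))^-1 *: (expR \o (fun t : R => - (t ^+ 2 / 2)))) //.
have E (a b c : R) : a * (b * - c) = - c * (a * b) by ring.
by apply: is_derive_eq; exact: E.
Qed.

(** With [u = z ^+ 2 / 2] these are [1 + u <= expR u] and [u ^+ 2 / 2 <= expR u], the normalising
    constant being at most 1. *)
Lemma gauss_pdf_mul_bounds {R : realType} (z : R) :
  gauss_pdf z * (1 + z ^+ 2 / 2) <= 1 /\ gauss_pdf z * (z ^+ 4 / 8) <= 1.
Proof.
have c1 : (Num.sqrt (2 * pi))^-1 <= 1 :> R.
  rewrite invf_le1 ?sqrtr_gt0 ?mulr_gt0 ?pi_gt0//.
  rewrite -[leLHS]sqrtr1 ler_wsqrtr//; have := pi_ge2 R; lra.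
have c0 : 0 <= (Num.sqrt (2 * pi))^-1 :> R by rewrite invr_ge0 sqrtr_ge0.
have z0 : 0 <= z ^+ 2 / 2 by rewrite divr_ge0 ?sqr_ge0.
have key y : y <= expR (z ^+ 2 / 2) -> gauss_pdf z * y <= 1.
  move=> yz; rewrite /gauss_pdf expRN -mulrA -[leRHS]mul1r.
  apply: (@le_trans _ _ ((Num.sqrt (2 * pi))^-1 * 1)); last by rewrite mulr1 mul1r.
  by rewrite ler_wpM2l// mulrC ler_pdivrMr ?expR_gt0// mul1r.
split; apply: key; first exact: expR_ge1Dx.
have := expR_ge1Dxn 1 z0; rewrite expr_div_n -exprM.
rewrite /factorial/=; lra.
Qed.

(** These control the second and third derivatives of [Phi] and the second derivative of
    [Phi (z / x)] in [x]. Each polynomial is dominated by a combination of the two factors in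
    [gauss_pdf_mul_bounds]. *)
Lemma Phi_heat_bounds {R : realType} (z : R) :
  [/\ gauss_pdf z * `|z| <= 1, gauss_pdf z * `|1 - z ^+ 2| <= 2 &
    gauss_pdf z * `|z ^+ 3 - 2 * z| <= 7].
Proof.
have [b2 b4] := gauss_pdf_mul_bounds z; have g0 := gauss_pdf_ge0 z.
set g := gauss_pdf z in g0 b2 b4 *.
have h y K L : y <= K * (1 + z ^+ 2 / 2) + L * (z ^+ 4 / 8) -> 0 <= K -> 0 <= L ->
    g * y <= K + L.
  move=> yKL K0 L0; have := ler_wpM2l g0 yKL; rewrite mulrDr (mulrCA g K) (mulrCA g L).
  move=> /le_trans; apply.
  by apply: lerD; rewrite ler_piMr.
have z2 : 0 <= z ^+ 2 by exact: sqr_ge0.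
split.
- rewrite -[leRHS]addr0; apply: h => //.
  have : 0 <= (1 - `|z|) ^+ 2 by exact: sqr_ge0.
  rewrite sqrrB real_normK ?num_real//; lra.
- rewrite -[leRHS]addr0; apply: h => //.
  by rewrite ler_norml; apply/andP; split; lra.
- have -> : 7 = 3 + 4 :> R by lra.
  apply: h => //.
  have -> : z ^+ 3 - 2 * z = z * (z ^+ 2 - 2) by ring.
  rewrite normrM.
  have w2 : z ^+ 2 = `|z| ^+ 2 by rewrite real_normK ?num_real.
  have -> : z ^+ 4 = (`|z| ^+ 2) ^+ 2 by rewrite -w2 -exprM.
  rewrite w2; set w := `|z|; have w0 : 0 <= w := normr_ge0 z.
  have w2_0 := sqr_ge0 w.
  have : `|w ^+ 2 - 2| <= w ^+ 2 + 2 by rewrite ler_norml; apply/andP; split; lra.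
  move=> /(ler_wpM2l w0) /le_trans; apply.
  (* The two squares give [2 * w <= 1 + w ^+ 2] and [2 * w ^+ 3 <= w ^+ 2 + w ^+ 4]. *)
  have : 0 <= (1 - w) ^+ 2 by exact: sqr_ge0.
  have : 0 <= (w - w ^+ 2) ^+ 2 by exact: sqr_ge0.
  nra.
Qed.

Lemma Phi_taylor {R : realType} (z y : R) :
  Phi z - gauss_pdf z * y + z * gauss_pdf z / 2 * y ^+ 2 - 2 * `|y| ^+ 3
  <= Phi (z + y).
Proof.
have D2 (x : R) : is_derive x 1 (fun x => - gauss_pdf x) (x * gauss_pdf x).
  have := is_deriveN (is_derive_gauss_pdf x).
  by rewrite mulNr opprK.
have D3 (x : R) : is_derive x 1 (fun x => x * gauss_pdf x)
    ((1 - x ^+ 2) * gauss_pdf x).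
  have E (a b : R) : a * (- a * b) + b * 1 = (1 - a ^+ 2) * b by ring.
  apply: is_derive_eq (is_deriveM (is_derive_id _ _) (is_derive_gauss_pdf x)) _.
  exact: E.
have := @taylor2_le R setT (@Phi R) (fun x => - gauss_pdf x) _ _ 2 z (z + y)
  (fun _ _ _ _ _ _ => I) I I (fun x _ => is_derive_Phi x) (fun x _ => D2 x)
  (fun x _ => D3 x).
have -> : z + y - z = y by ring.
rewrite ler_norml => H.
have /H/andP[+ _] : forall x : R, setT x -> `|(1 - x ^+ 2) * gauss_pdf x| <= 2.
  move=> x _; have [_ + _] := Phi_heat_bounds x.
  by rewrite normrM mulrC [`|gauss_pdf x|]ger0_norm// gauss_pdf_ge0.
lra.
Qed.

(** First-order expansion of [Phi (z / x)] in [x] at [x = 1]. The slope [z * gauss_pdf z] is also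
    the second derivative of [Phi] at [z]: this is the heat equation. *)
Lemma Phi_div_le {R : realType} (z l : R) : 1 <= l ->
  Phi (z / l) <= Phi z + z * gauss_pdf z * (l - 1) + 7 * (l - 1) ^+ 2.
Proof.
move=> l1.
pose w (x : R) := z / x.
have Dw (x : R) : 1 <= x -> is_derive x 1 w (- (w x / x)).
  move=> x1; have x0 : x != 0 by rewrite gt_eqF// (lt_le_trans ltr01).
  have Dinv := is_deriveM (is_derive_cst z x 1) (is_deriveV x0 (is_derive_id x 1)).
  apply: is_derive_eq Dinv _.
  by rewrite /w /GRing.scale/=; field.
have Dgw (x : R) : 1 <= x ->
    is_derive x 1 (gauss_pdf \o w) (w x ^+ 2 * gauss_pdf (w x) / x).
  move=> /Dw Dx.
  apply: is_derive_eq (is_derive1_comp (is_derive_gauss_pdf _) Dx) _.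
  by ring.
have D1 (x : R) : 1 <= x ->
    is_derive x 1 (@Phi R \o w) (w x / x * gauss_pdf (w x)).
  move=> /Dw Dx; apply: is_derive_eq (is_derive1_comp (is_derive_Phi _) Dx) _.
  by ring.
have D2 (x : R) : 1 <= x ->
    is_derive x 1 (fun x => w x / x * gauss_pdf (w x))
      ((w x ^+ 3 - 2 * w x) * gauss_pdf (w x) / x ^+ 2).
  move=> x1; have x0 : x != 0 by rewrite gt_eqF// (lt_le_trans ltr01).
  have Dwx := is_deriveM (Dw _ x1) (is_deriveV x0 (is_derive_id x 1)).
  apply: is_derive_eq (is_deriveM Dwx (Dgw _ x1)) _.
  by rewrite fctE /GRing.scale/=; field.
have I1 : is_interval [set x : R | 1 <= x].
  by move=> a b /= a1 b1 c /andP[ac _]; exact: le_trans ac.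
have := @taylor1_le R [set x | 1 <= x] _ _ _ 7 1 l I1 (lexx _) l1 D1 D2.
rewrite /= /w !divr1 ler_norml => H.
have /H/andP[_] : forall x : R, 1 <= x ->
    `|(w x ^+ 3 - 2 * w x) * gauss_pdf (w x) / x ^+ 2| <= 7.
  move=> x x1; have [_ _ +] := Phi_heat_bounds (w x).
  rewrite [_ * gauss_pdf _]mulrC 2!normrM [`|gauss_pdf _|]ger0_norm ?gauss_pdf_ge0//.
  move=> /(le_trans _); apply; rewrite ler_piMr//.
    by rewrite mulr_ge0 ?gauss_pdf_ge0.
  rewrite ger0_norm ?invr_ge0 ?sqr_ge0// invf_le1 ?exprn_gt0 ?(lt_le_trans _ x1)//.
  by rewrite expr_ge1// (le_trans _ x1).
rewrite real_normK ?num_real//; lra.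
Qed.

(* One step of the discrete heat flow: a centred step of variance [e ^+ 2] acts
   on [Phi (_ / rho)] like the change of [rho ^+ 2] into [rho ^+ 2 + e ^+ 2]. *)
Lemma Phi_heat {R : realType} (z e y : R) : 0 <= e ->
  Phi (z / Num.sqrt (1 + e ^+ 2)) - gauss_pdf z * (e * y)
    + z * gauss_pdf z / 2 * e ^+ 2 * (y ^+ 2 - 1)
    - 2 * e ^+ 3 * `|y| ^+ 3 - 2 * e ^+ 4 <= Phi (z + e * y).
Proof.
move=> e0; have := Phi_taylor z (e * y).
rewrite exprMn normrM (ger0_norm e0) [(e * `|y|) ^+ 3]exprMn.
set l := Num.sqrt _.
have l2 : l ^+ 2 = 1 + e ^+ 2 by rewrite sqr_sqrtr// addr_ge0// sqr_ge0.
have l0 : 0 <= l by exact: sqrtr_ge0.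
have l1 : 1 <= l by rewrite -[leLHS]sqrtr1 ler_wsqrtr// lerDl sqr_ge0.
have := Phi_div_le z l1.
have [+ _ _] := Phi_heat_bounds z.
rewrite mulrC -[X in _ * X]ger0_norm ?gauss_pdf_ge0// -normrM ler_norml => /andP[g1 g2].
set g := z * gauss_pdf z in g1 g2 *.
have e2 : e ^+ 2 = (l - 1) * (l + 1) by rewrite -[e ^+ 2](addKr 1) -l2; ring.
have le : l - 1 <= e ^+ 2 / 2 by rewrite e2; nra.
have l4 : (l - 1) ^+ 2 <= e ^+ 4 / 4.
  have -> : e ^+ 4 / 4 = (e ^+ 2 / 2) ^+ 2 by field.
  by rewrite lerXn2r ?nnegrE ?divr_ge0 ?subr_ge0// sqr_ge0.
(* The first-order effect of the scale change matches the second-order Taylor term of a step of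
   variance [e ^+ 2]. What remains is at most [15 / 2 * (l - 1) ^+ 2], hence at most
   [2 * e ^+ 4]. *)
have -> : g * (l - 1) = g / 2 * e ^+ 2 - g * ((l - 1) ^+ 2 / 2).
  by rewrite e2; field.
have : - (g * ((l - 1) ^+ 2 / 2)) <= (l - 1) ^+ 2 / 2.
  have : 0 <= (l - 1) ^+ 2 / 2 by rewrite divr_ge0 ?sqr_ge0.
  nra.
have -> : g / 2 * e ^+ 2 * (y ^+ 2 - 1) = g / 2 * (e ^+ 2 * y ^+ 2) - g / 2 * e ^+ 2.
  by ring.
set A := (l - 1) ^+ 2; set B := e ^+ 4; rewrite -/A -/B in l4 *.
have B0 : 0 <= B by rewrite exprn_even_ge0.
lra.
Qed.

(** * A central limit theorem for tensor powers *)

Lemma measurable_Phi {R : realType} : measurable_fun setT (@Phi R).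
Proof.
apply: continuous_measurable_fun => x.
have := is_derive_Phi x => Dx.
exact/differentiable_continuous/derivable1_diffP.
Qed.

Lemma bounded_integrable {R : realType} {d} {T : measurableType d}
    (P : probability T R) (f : T -> R) (K : R) :
  measurable_fun setT f -> (forall t, `|f t| <= K) ->
  P.-integrable setT (EFin \o f).
Proof.
move=> mf fK; apply: measurable_bounded_integrable => //.
  by apply: le_lt_trans (ltry 1); exact: probability_le1.
exists K; split; first exact: num_real.
by move=> M KM t _; exact: le_trans (fK t) (ltW KM).
Qed.

(** [Phi_heat] integrated and rescaled by [rho]. The error is stated with the lower bound [sg] of
    [rho], so that it stays the same while the scale grows from step to step. *)
Lemma Phi_heat_integral {R : realType} {d} {T : measurableType d}
    (P : probability T R) (Y : T -> R) (B x rho sg e : R) :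
  measurable_fun setT Y -> (forall t, `|Y t| <= B) ->
  \int[P]_t Y t = 0 -> \int[P]_t (Y t ^+ 2) = 1 ->
  0 <= e -> 0 < sg -> sg <= rho ->
  ((Phi (x / Num.sqrt (rho ^+ 2 + e ^+ 2)))%:E <=
   \int[P]_t (Phi ((x + e * Y t) / rho))%:E +
     (2 * B ^+ 3 * (e / sg) ^+ 3 + 2 * (e / sg) ^+ 4)%:E)%E.
Proof.
move=> mY YB EY EY2 e0 sg0 sgr.
have r0 : 0 < rho by exact: lt_le_trans sgr.
pose e' := e / rho; pose z := x / rho.
pose err := 2 * B ^+ 3 * (e / sg) ^+ 3 + 2 * (e / sg) ^+ 4; rewrite -/err.
have e'0 : 0 <= e' by rewrite divr_ge0// ltW.
have e's : e' <= e / sg by rewrite ler_wpM2l// lef_pV2.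
have intY := bounded_integrable P mY YB.
have mY2 : measurable_fun setT (fun t => Y t ^+ 2) by exact: measurable_funX.
have intY2 : P.-integrable setT (EFin \o (fun t => Y t ^+ 2)).
  apply: (@bounded_integrable _ _ _ _ _ (B ^+ 2)) => // t.
  by rewrite normrX lerXn2r ?nnegrE// (le_trans _ (YB t)).
(* [h] is the quadratic minorant supplied by [Phi_heat]; as [Y] has mean 0 and second moment 1, its
   integral is [k]. *)
pose k := Phi (z / Num.sqrt (1 + e' ^+ 2)) - err.
pose b := - gauss_pdf z * e'; pose c := z * gauss_pdf z / 2 * e' ^+ 2.
pose h t := (k - c) + (b * Y t + c * Y t ^+ 2).
have hE t : h t <= Phi ((x + e * Y t) / rho).
  have -> : (x + e * Y t) / rho = z + e' * Y t by rewrite mulrDl mulrAC.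
  apply: le_trans (Phi_heat z (Y t) e'0).
  have B0 : 0 <= B by exact: le_trans (YB t).
  have : 2 * e' ^+ 3 * `|Y t| ^+ 3 + 2 * e' ^+ 4 <= err.
    have es0 : 0 <= e / sg by exact: le_trans e's.
    have H3 : e' ^+ 3 * `|Y t| ^+ 3 <= (e / sg) ^+ 3 * B ^+ 3.
      by rewrite ler_pM ?exprn_ge0// lerXn2r ?nnegrE.
    have H4 : e' ^+ 4 <= (e / sg) ^+ 4 by rewrite lerXn2r ?nnegrE.
    by rewrite /err; lra.
  by rewrite /h /k /b /c; lra.
have mh : measurable_fun setT (fun t => b * Y t + c * Y t ^+ 2).
  by apply: measurable_funD; exact: measurable_funM.
have inth1 : P.-integrable setT (EFin \o (fun t => b * Y t)).
  exact: integrableZl intY.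
have inth2 : P.-integrable setT (EFin \o (fun t => c * Y t ^+ 2)).
  exact: integrableZl intY2.
have inth3 : P.-integrable setT (EFin \o (fun t => b * Y t + c * Y t ^+ 2)).
  exact: integrableD inth1 inth2.
have intc : P.-integrable setT (EFin \o cst (k - c)).
  by apply: (@bounded_integrable _ _ _ _ _ `|k - c|) => //.
have inth : P.-integrable setT (EFin \o h) by exact: integrableD intc inth3.
have mPhi : measurable_fun setT (fun t => Phi ((x + e * Y t) / rho)).
  apply: measurableT_comp measurable_Phi _; apply: measurable_funM => //.
  by apply: measurable_funD => //; exact: measurable_funM.
have intPhi : P.-integrable setT (EFin \o (fun t => Phi ((x + e * Y t) / rho))).
  apply: (@bounded_integrable _ _ _ _ _ 1) => // t.
  by rewrite ger0_norm ?Phi_le1// Phi_ge0.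
have ih : \int[P]_t h t = k.
  rewrite (RintegralD measurableT intc inth3) (RintegralD measurableT inth1 inth2).
  rewrite (RintegralZl b measurableT intY) (RintegralZl c measurableT intY2) EY EY2.
  have -> : \int[P]_(t in setT) (k - c) = k - c.
    transitivity ((k - c) * fine (P setT)); first exact: Rintegral_cst.
    by rewrite probability_setT mulr1.
  by ring.
have rE : x / Num.sqrt (rho ^+ 2 + e ^+ 2) = z / Num.sqrt (1 + e' ^+ 2).
  have -> : rho ^+ 2 + e ^+ 2 = rho ^+ 2 * (1 + e' ^+ 2).
    by rewrite /e'; field; rewrite gt_eqF.
  have s0 : 0 < Num.sqrt (1 + e' ^+ 2) by rewrite sqrtr_gt0 ltr_wpDr ?sqr_ge0.
  rewrite sqrtrM ?sqr_ge0// sqrtr_sqr gtr0_norm// /z; field.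
  by rewrite !gt_eqF.
rewrite rE -leeBlDr// -EFinB -/k -ih /Rintegral fineK; last exact: integrable_fin_num.
by apply: le_integral => // t _; rewrite lee_fin.
Qed.

Lemma measurable_tuple_sum {R : realType} {d} {T : measurableType d}
    (Y : T -> R) (n : nat) :
  measurable_fun setT Y ->
  measurable_fun setT (fun t : n.-tuple T => \sum_(i < n) Y (tnth t i)).
Proof.
by move=> mY; apply: measurable_sum => i; exact: measurableT_comp (measurable_tnth i).
Qed.

Lemma ge0_integral_tensor_powerS {R : realType} {d} {T : measurableType d}
    (P : probability T R) (n : nat) (f : n.+1.-tuple T -> \bar R) :
  measurable_fun [set: n.+1.-tuple T] f -> (forall t, (0 <= f t)%E) ->
  (\int[tensor_power P n.+1]_t f t =
   \int[P]_y \int[tensor_power P n]_t f [tuple of y :: t])%E.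
Proof.
move=> mf f0; rewrite ge0_integral_distribution// fubini_tonelli1//.
  by apply: measurableT_comp mf _; exact: measurable_tuple_cons.
by move=> x; exact: f0.
Qed.

(** Lindeberg exchange by induction on [n]. For a fixed first coordinate [y], the induction
    hypothesis starts from [x + e * Y y] and reaches the scale [rn]; integrating over [y] is then
    one more heat step. The [n] errors add up. *)
Lemma Phi_tensor_power {R : realType} {d} {T : measurableType d}
    (P : probability T R) (Y : T -> R) (B x rho sg e : R) (n : nat) :
  measurable_fun setT Y -> 0 <= B -> (forall t, `|Y t| <= B) ->
  \int[P]_t Y t = 0 -> \int[P]_t (Y t ^+ 2) = 1 ->
  0 <= e -> 0 < sg -> sg <= rho ->
  ((Phi (x / Num.sqrt (rho ^+ 2 + n%:R * e ^+ 2)))%:E <=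
   \int[tensor_power P n]_t
     (Phi ((x + e * \sum_(i < n) Y (tnth t i)) / rho))%:E +
     (n%:R * (2 * B ^+ 3 * (e / sg) ^+ 3 + 2 * (e / sg) ^+ 4))%:E)%E.
Proof.
move=> mY B0 YB EY EY2 e0 sg0 sgr.
pose err := 2 * B ^+ 3 * (e / sg) ^+ 3 + 2 * (e / sg) ^+ 4; rewrite -/err.
have r0 : 0 < rho by exact: lt_le_trans sgr.
have mPhi m y : measurable_fun setT (fun t : m.-tuple T =>
    (Phi ((y + e * \sum_(i < m) Y (tnth t i)) / rho))%:E).
  apply/measurable_EFinP; apply: measurableT_comp measurable_Phi _.
  apply: measurable_funM => //; apply: measurable_funD => //.
  by apply: measurable_funM => //; exact: measurable_tuple_sum.
have Phi0 (y : R) : (0 <= (Phi y)%:E)%E by rewrite lee_fin Phi_ge0.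
elim: n x => [|n IHn] x.
  rewrite mul0r addr0 sqrtr_sqr gtr0_norm// mul0r adde0.
  rewrite integral_dirac//; last exact: mPhi.
  by rewrite diracT mul1e big_ord0 mulr0 addr0.
pose rn := Num.sqrt (rho ^+ 2 + n%:R * e ^+ 2).
have rn2 : rn ^+ 2 = rho ^+ 2 + n%:R * e ^+ 2.
  by rewrite sqr_sqrtr// addr_ge0 ?sqr_ge0// mulr_ge0// sqr_ge0.
have sgrn : sg <= rn.
  apply: (le_trans sgr); rewrite -[leLHS](gtr0_norm r0) -[leLHS]sqrtr_sqr.
  by rewrite ler_wsqrtr// lerDl mulr_ge0// sqr_ge0.
have err0 : 0 <= err.
  have es0 : 0 <= e / sg by rewrite divr_ge0// ltW.
  by apply: addr_ge0; apply: mulr_ge0; rewrite ?exprn_ge0//; apply: mulr_ge0; rewrite ?exprn_ge0.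
pose g (t : n.+1.-tuple T) :=
  (Phi ((x + e * \sum_(i < n.+1) Y (tnth t i)) / rho))%:E.
have mg : measurable_fun setT (g \o @tuple_cons _ T n).
  by apply: measurableT_comp (mPhi n.+1 x) _; exact: measurable_tuple_cons.
pose F (y : T) : \bar R := (\int[tensor_power P n]_t
  (Phi ((x + e * Y y + e * \sum_(i < n) Y (tnth t i)) / rho))%:E)%E.
have gE (y : T) (t : n.-tuple T) : g [tuple of y :: t] =
    (Phi ((x + e * Y y + e * \sum_(i < n) Y (tnth t i)) / rho))%:E.
  rewrite /g big_ord_recl tnth0 mulrDr addrA.
  by under eq_bigr => i _ do rewrite tnthS.
have F0 y : (0 <= F y)%E by apply: integral_ge0 => t _; exact: Phi0.
have mF : measurable_fun setT F.
  have -> : F = fubini_F (tensor_power P n) (g \o @tuple_cons _ T n).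
    by apply/funext => y; apply/esym; apply: eq_integral => t _; exact: gE.
  by apply: measurable_fun_fubini_tonelli_F => // t; exact: Phi0.
have -> : (\int[tensor_power P n.+1]_t g t = \int[P]_y F y)%E.
  rewrite ge0_integral_tensor_powerS; [|exact: mPhi|by move=> t; exact: Phi0].
  by apply: eq_integral => y _; apply: eq_integral => t _; exact: gE.
have mPhiY : measurable_fun setT (fun t => (Phi ((x + e * Y t) / rn))%:E).
  apply/measurable_EFinP; apply: measurableT_comp measurable_Phi _.
  apply: measurable_funM => //; apply: measurable_funD => //.
  exact: measurable_funM.
have nerr0 : (0 <= (n%:R * err)%:E)%E by rewrite lee_fin mulr_ge0.
have step : (\int[P]_t (Phi ((x + e * Y t) / rn))%:E <=
    \int[P]_y F y + (n%:R * err)%:E)%E.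
  have -> : ((n%:R * err)%:E = \int[P]_y (cst (n%:R * err)%:E y))%E.
    transitivity ((n%:R * err)%:E * P setT)%E.
      by rewrite probability_setT mule1.
    by rewrite integral_cst.
  rewrite -ge0_integralD//.
  by apply: ge0_le_integral => //; exact: emeasurable_funD.
have := Phi_heat_integral x mY YB EY EY2 e0 sg0 sgrn.
have -> : rn ^+ 2 + e ^+ 2 = rho ^+ 2 + n.+1%:R * e ^+ 2.
  by rewrite rn2 -natr1; ring.
move=> /le_trans; apply; rewrite -/err.
have -> : n.+1%:R * err = n%:R * err + err by rewrite -natr1; ring.
by rewrite [(_ * err + err)%:E]EFinD addeA; apply: leeD2r.
Qed.

(** * From the smooth test function to tail probabilities *)

Lemma Phi_decr {R : realType} (x y : R) : x < y -> Phi y < Phi x.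
Proof.
move=> xy; have [c [_ _ _ E]] := @MVT_interval R setT _ _ x y
  (fun _ _ _ _ _ _ => I) I I (fun t _ => is_derive_Phi t).
by rewrite -subr_lt0 E nmulr_rlt0 ?subr_gt0// oppr_lt0 gauss_pdf_gt0.
Qed.

Lemma Phi_nincr {R : realType} (x y : R) : x <= y -> Phi y <= Phi x.
Proof.
by rewrite le_eqVlt => /predU1P[->//|xy]; exact/ltW/Phi_decr.
Qed.

(** With [S] the sum of the [Y], [Phi ((t - S / sqrt n) / sg)] is a smoothed indicator of the event:
    at most 1 on it and at most [Phi ((t - s) / sg)] off it. Since [Phi] decreases, the exchange is
    applied to [- Y]. *)
Lemma tail_tensor_power_ge {R : realType} {d} {T : measurableType d}
    (P : probability T R) (Y : T -> R) (B s t sg : R) (n : nat) :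
  measurable_fun setT Y -> 0 <= B -> (forall y, `|Y y| <= B) ->
  \int[P]_y Y y = 0 -> \int[P]_y (Y y ^+ 2) = 1 ->
  0 <= t -> s <= t -> 0 < sg -> (0 < n)%N ->
  ((Phi t)%:E <= tensor_power P n
      [set y | (s * Num.sqrt n%:R <= \sum_(i < n) Y (tnth y i))%R] +
    (Phi ((t - s) / sg) +
     (2 * B ^+ 3 / sg ^+ 3 + 2 / sg ^+ 4) / Num.sqrt n%:R)%:E)%E.
Proof.
move=> mY B0 YB EY EY2 t0 st sg0 n0.
set E := [set y | _]; set q := Num.sqrt n%:R; pose e := q^-1.
have q2 : q ^+ 2 = n%:R by rewrite sqr_sqrtr.
have q1 : 1 <= q by rewrite -[leLHS]sqrtr1 ler_wsqrtr// ler1n.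
have q0 : 0 < q by exact: lt_le_trans ltr01 q1.
pose S (y : n.-tuple T) := \sum_(i < n) Y (tnth y i).
have mS : measurable_fun setT S by exact: measurable_tuple_sum.
have mE : measurable E.
  rewrite -[E]setTI; have -> : E = S @^-1` `[s * q, +oo[.
    by apply/seteqP; split=> y; rewrite /= in_itv/= andbT.
  by apply: mS => //; exact: measurable_itv.
have mNY : measurable_fun setT (fun y => - Y y) by exact: measurableT_comp.
have NYB y : `|- Y y| <= B by rewrite normrN.
have ENY : \int[P]_y (- Y y) = 0.
  under eq_Rintegral do rewrite -mulN1r.
  by rewrite RintegralZl ?EY ?mulr0//; exact: bounded_integrable YB.
have ENY2 : \int[P]_y ((- Y y) ^+ 2) = 1.
  by under eq_Rintegral do rewrite sqrrN.
have e0 : 0 <= e by rewrite invr_ge0 ltW.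
have := Phi_tensor_power t n mNY B0 NYB ENY ENY2 e0 sg0 (lexx sg).
have -> : n%:R * e ^+ 2 = 1 by rewrite -q2 /e; field; rewrite gt_eqF.
(* Here [0 <= t] matters: a scale above 1 moves [t] towards 0 and so raises [Phi]. *)
have tPhi : Phi t <= Phi (t / Num.sqrt (sg ^+ 2 + 1)).
  apply: Phi_nincr; rewrite ler_piMr// invf_le1 ?sqrtr_gt0 ?ltr_wpDl ?sqr_ge0//.
  by rewrite -[leLHS]sqrtr1 ler_wsqrtr// lerDr sqr_ge0.
rewrite -lee_fin in tPhi; move=> /(le_trans tPhi) /le_trans; apply.
rewrite EFinD addeA; apply: leeD; last first.
  (* As [n * e ^+ 2 = 1], the sum of [n] errors is still of order [e]. *)
  have -> : n%:R * (2 * B ^+ 3 * (e / sg) ^+ 3 + 2 * (e / sg) ^+ 4) =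
      2 * B ^+ 3 / sg ^+ 3 * e + 2 / sg ^+ 4 * e ^+ 2.
    by rewrite -q2 /e; field; rewrite !gt_eqF.
  have e2 : e ^+ 2 <= e by rewrite expr2 ler_piMr// invf_le1.
  rewrite lee_fin -/e [leRHS]mulrDl; apply: lerD => //; apply: ler_wpM2l => //.
  by rewrite divr_ge0 ?exprn_ge0// ltW.
have -> : (tensor_power P n E + (Phi ((t - s) / sg))%:E =
    \int[tensor_power P n]_y ((\1_E y)%:E + cst (Phi ((t - s) / sg))%:E y))%E.
  rewrite ge0_integralD//.
  - rewrite integral_indic// setIT; congr (_ + _)%E.
    transitivity ((Phi ((t - s) / sg))%:E * tensor_power P n setT)%E.
      by rewrite probability_setT mule1.
    by rewrite integral_cst.
  - by apply/measurable_EFinP; exact: measurable_indic.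
  - by move=> y _; rewrite lee_fin Phi_ge0.
have mPhi : measurable_fun setT (fun y : n.-tuple T =>
    (Phi ((t + e * \sum_(i < n) - Y (tnth y i)) / sg))%:E).
  apply/measurable_EFinP; apply: measurableT_comp measurable_Phi _.
  apply: measurable_funM => //; apply: measurable_funD => //.
  apply: measurable_funM => //.
  exact: (@measurable_tuple_sum _ _ _ (fun y => - Y y)).
apply: ge0_le_integral => //.
- by move=> y _; rewrite lee_fin Phi_ge0.
- apply: emeasurable_funD => //.
  by apply/measurable_EFinP; exact: measurable_indic.
move=> y _; rewrite -EFinD lee_fin sumrN mulrN.
have [yE|yE] := boolP (y \in E).
  by rewrite indicE yE (le_trans (Phi_le1 _))// lerDl Phi_ge0.
rewrite indicE (negbTE yE) add0r; apply: Phi_nincr.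
rewrite ler_wpM2r ?invr_ge0 ?(ltW sg0)// lerD2l lerN2 mulrC ler_pdivrMr// ltW//.
by rewrite ltNge; apply: contra yE; rewrite inE.
Qed.

(** The gap between [Phi t] and [Phi r], for [t] midway between [s] and [r], pays for two errors:
    half for the smoothing, made small by [sg], and half for the exchange, made small by [n]. *)
Lemma tail_tensor_power {R : realType} {d} {T : measurableType d}
    (P : probability T R) (Y : T -> R) (B r s : R) :
  measurable_fun setT Y -> (forall y, `|Y y| <= B) ->
  \int[P]_y Y y = 0 -> \int[P]_y (Y y ^+ 2) = 1 ->
  0 < s -> s < r ->
  \forall n \near \oo, ((Phi r)%:E < tensor_power P n
    [set y | (s * Num.sqrt n%:R <= \sum_(i < n) Y (tnth y i))%R])%E.
Proof.
move=> mY YB EY EY2 s0 sr.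
have {}YB y : `|Y y| <= `|B| by exact: le_trans (YB y) (ler_norm B).
pose t := (s + r) / 2; pose h := (Phi t - Phi r) / 2.
have st : s < t by rewrite /t; lra.
have h0 : 0 < h by rewrite divr_gt0// subr_gt0 Phi_decr// /t; lra.
have [z zh] := Phi_small h0.
(* Chosen so that [(t - s) / sg] is beyond [z], where [Phi] is already below [h]. *)
pose sg := (t - s) / (`|z| + 1).
have z0 : 0 < `|z| + 1 by rewrite ltr_wpDl.
have sg0 : 0 < sg by rewrite divr_gt0// subr_gt0.
have sgz : Phi ((t - s) / sg) < h.
  apply: le_lt_trans zh; apply: Phi_nincr.
  rewrite (_ : (t - s) / sg = `|z| + 1); first by rewrite (le_trans (ler_norm z))// lerDl.
  by rewrite /sg; field; rewrite !gt_eqF ?subr_gt0.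
set K := 2 * `|B| ^+ 3 / sg ^+ 3 + 2 / sg ^+ 4.
have K0 : 0 <= K.
  have sgV m : 0 <= (sg ^+ m)^-1 by rewrite invr_ge0 exprn_ge0// ltW.
  by apply: addr_ge0; apply: mulr_ge0 => //; apply: mulr_ge0 => //; exact: exprn_ge0.
exists (Num.bound ((K / h) ^+ 2)).+1 => // n /= Nn.
have n0 : (0 < n)%N by exact: leq_trans Nn.
have q0 : 0 < Num.sqrt n%:R :> R by rewrite sqrtr_gt0 ltr0n.
have Kq : K / Num.sqrt n%:R < h.
  rewrite ltr_pdivrMr// mulrC -ltr_pdivrMr//.
  have Kh0 : 0 <= K / h by rewrite divr_ge0// ltW.
  rewrite -[ltLHS](ger0_norm Kh0) -[ltLHS]sqrtr_sqr ltr_sqrt ?ltr0n//.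
  apply: lt_trans (archi_boundP (sqr_ge0 _)) _.
  by rewrite ltr_nat.
have t0 : 0 <= t by rewrite ltW// (lt_trans s0).
have := tail_tensor_power_ge mY (normr_ge0 B) YB EY EY2 t0 (ltW st) sg0 n0.
rewrite -/K -leeBlDr//; apply: lt_le_trans.
rewrite -EFinB lte_fin; rewrite /h in sgz Kq; lra.
Qed.

(** * Lipschitz functions on l_p-products *)

(** For [v <= u], Young's inequality for [v * u ^ (p - 1)] gives the tangent bound [u ^ p - v ^ p <=
    p * u ^ (p - 1) * (u - v)], valid at 0 as well. *)
Lemma powR_sub_le {R : realType} (p D a b : R) : 1 < p ->
  0 <= a <= D -> 0 <= b <= D ->
  `|a `^ p - b `^ p| <= p * D `^ (p - 1) * `|a - b|.
Proof.
move=> p1.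
have p0 : 0 < p by exact: lt_trans p1.
have pn0 : p != 0 by rewrite gt_eqF.
have pm0 : 0 < p - 1 by rewrite subr_gt0.
have key u v : 0 <= v -> v <= u -> u <= D ->
    u `^ p - v `^ p <= p * D `^ (p - 1) * (u - v).
  move=> v0 vu uD; have u0 : 0 <= u by exact: le_trans vu.
  pose q := p / (p - 1).
  have q0 : 0 < q by rewrite divr_gt0.
  have pq : p^-1 + q^-1 = 1 by rewrite /q; field; rewrite !gt_eqF.
  have := conjugate_powR v0 (powR_ge0 u (p - 1)) p0 q0 pq.
  rewrite -powRrM.
  have -> : (p - 1) * q = p by rewrite /q; field; rewrite gt_eqF.
  have uE := mulr_powRB1 u0 p0.
  rewrite -(ler_pM2l p0) mulrDr.
  have -> : p * (v `^ p / p) = v `^ p by field.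
  have -> : p * (u `^ p / q) = (p - 1) * u `^ p by rewrite /q; field; rewrite gt_eqF.
  move=> H; apply: (@le_trans _ _ (p * u `^ (p - 1) * (u - v))).
    by rewrite mulrBr -!mulrA [u `^ (p - 1) * u]mulrC uE [_ * v]mulrC; lra.
  rewrite ler_wpM2r ?subr_ge0// ler_wpM2l ?(ltW p0)//.
  by apply: ge0_ler_powR; rewrite ?nnegrE ?(ltW pm0)//; exact: le_trans uD.
move=> /andP[a0 aD] /andP[b0 bD].
have [ab|/ltW ba] := leP a b.
  rewrite distrC [`|a - b|]distrC !ger0_norm ?subr_ge0//; first exact: key.
  by apply: ge0_ler_powR; rewrite ?nnegrE ?(ltW p0).
rewrite !ger0_norm ?subr_ge0//; first exact: key.
by apply: ge0_ler_powR; rewrite ?nnegrE ?(ltW p0).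
Qed.

(** The fractions [a / (a + b)] and [b / (a + b)] lie in the unit interval, where a power [q <= 1]
    does not decrease them, and they sum to 1. *)
Lemma powR_subadd {R : realType} (q a b : R) : 0 < q <= 1 ->
  0 <= a -> 0 <= b -> (a + b) `^ q <= a `^ q + b `^ q.
Proof.
move=> /andP[q0 q1] a0 b0.
have [ab0|] := eqVneq (a + b) 0.
  by rewrite ab0 powR0 ?gt_eqF// addr_ge0// powR_ge0.
move=> ab0; have {}ab0 : 0 < a + b by rewrite lt_neqAle eq_sym ab0 addr_ge0.
have key u : 0 <= u -> u <= a + b -> u / (a + b) * (a + b) `^ q <= u `^ q.
  move=> u0 uab.
  have [->|un0] := eqVneq u 0; first by rewrite !mul0r powR_ge0.
  have {}u0 : 0 < u by rewrite lt_neqAle eq_sym un0.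
  have -> : u `^ q = (u / (a + b)) `^ q * (a + b) `^ q.
    by rewrite -powRM ?divfK ?gt_eqF// ?divr_ge0// ltW.
  rewrite ler_wpM2r ?powR_ge0// ger1_powR// divr_gt0//=.
  by rewrite ler_pdivrMr// mul1r.
have -> : (a + b) `^ q = a / (a + b) * (a + b) `^ q + b / (a + b) * (a + b) `^ q.
  by rewrite -mulrDl -mulrDl divff ?mul1r// gt_eqF.
by apply: lerD; apply: key => //; rewrite ?lerDl ?lerDr.
Qed.

Lemma powR_max0_lipschitz {R : realType} (q a b : R) : 0 < q <= 1 ->
  `|(Num.max 0 a) `^ q - (Num.max 0 b) `^ q| <= `|a - b| `^ q.
Proof.
move=> q01; have /andP[q0 q1] := q01.
wlog ab : a b / b <= a => [hw|].
  have [/hw//|/ltW /hw] := leP b a.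
  by rewrite distrC [`|b - a|]distrC.
have m0 (x : R) : 0 <= Num.max 0 x by rewrite le_max lexx.
have mab : Num.max 0 b <= Num.max 0 a by rewrite ge_max !le_max lexx ab orbT.
rewrite ger0_norm ?subr_ge0; last first.
  by apply: ge0_ler_powR; rewrite ?nnegrE ?(ltW q0).
rewrite ger0_norm ?subr_ge0// lerBlDr.
apply: (le_trans _ (powR_subadd q01 _ _)); rewrite ?subr_ge0//.
have ab0 : 0 <= a - b + Num.max 0 b by rewrite addr_ge0 ?subr_ge0.
apply: ge0_ler_powR; rewrite ?nnegrE ?(ltW q0)//.
rewrite ge_max ab0/= -[leLHS](subrK b) lerD2l.
by rewrite le_max lexx orbT.
Qed.

(** * Lower bounds for observable diameters *)

Lemma limn_einf_ge {R : realType} (u : (\bar R)^nat) (c : \bar R) :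
  (\forall n \near \oo, (c <= u n)%E) -> (c <= limn_einf u)%E.
Proof.
move=> [N _ Nu]; rewrite limn_einf_lim.
apply: lime_ge; first exact: is_cvg_einfs.
exists N => // m /= Nm; apply: le_ereal_inf_tmp => _ [n /= mn <-].
by apply: Nu; exact: leq_trans mn.
Qed.

Lemma diam_ge0 {R : realType} (T : Type) (d : T -> T -> R) (A : set T) :
  (0 <= diam d A)%E.
Proof. by rewrite /diam le_max lexx. Qed.

Lemma diam_ge {R : realType} (T : Type) (d : T -> T -> R) (A : set T) (x y : T) :
  A x -> A y -> ((d x y)%:E <= diam d A)%E.
Proof.
move=> Ax Ay; rewrite /diam le_max; apply/orP; right.
by apply: ereal_sup_ubound; exists (x, y).
Qed.

Lemma obs_diam_ge0 {R : realType} {disp} {T : measurableType disp}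
    (d : T -> T -> R) (mu : set T -> \bar R) (kappa : R) :
  (forall x y, 0 <= d x y) -> (0 <= obs_diam d mu kappa)%E.
Proof.
move=> d0; apply: le_trans (ereal_sup_ubound _); last first.
  by exists (cst 0) => // x y; rewrite subrr normr0.
by apply: le_ereal_inf_tmp => _ [A _ <-]; exact: diam_ge0.
Qed.

Lemma probability_meet {R : realType} {disp} {T : measurableType disp}
    (P : probability T R) (kappa : R) (A E : set T) :
  measurable A -> measurable E ->
  ((1 - kappa)%:E <= P A)%E -> (kappa%:E < P E)%E -> (A `&` E) !=set0.
Proof.
move=> mA mE PA PE; apply/set0P/eqP => AE.
have := probability_le1 P (measurableU _ _ mA mE).
rewrite measureU// leNgt => /negP; apply.
have -> : 1%E = ((1 - kappa)%:E + kappa%:E)%E by rewrite -EFinD subrK.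
by apply: lee_ltD.
Qed.

Lemma measurable_sublevel {R : realType} {disp} {T : measurableType disp}
    (f : T -> R) (a : R) :
  measurable_fun setT f -> measurable [set t | f t <= a].
Proof.
move=> mf; rewrite (_ : mkset _ = f @^-1` `]-oo, a]); last first.
  by apply/seteqP; split=> t; rewrite /= in_itv.
by rewrite -[X in measurable X]setTI; apply: mf => //; exact: measurable_itv.
Qed.

Lemma measurable_superlevel {R : realType} {disp} {T : measurableType disp}
    (f : T -> R) (a : R) :
  measurable_fun setT f -> measurable [set t | a <= f t].
Proof.
move=> mf; rewrite (_ : mkset _ = f @^-1` `[a, +oo[); last first.
  by apply/seteqP; split=> t; rewrite /= in_itv/= andbT.
by rewrite -[X in measurable X]setTI; apply: mf => //; exact: measurable_itv.
Qed.

(** The preimage of any Borel set of mass at least [1 - kappa] meets both events, so the set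
    contains a point below [a] and one above [b]. *)
Lemma obs_diam_ge {R : realType} {disp} {T : measurableType disp}
    (d : T -> T -> R) (P : probability T R) (kappa : R) (f : T -> R) (a b : R) :
  measurable_fun setT f -> lipschitz1 d f ->
  (kappa%:E < P [set t | f t <= a]%R)%E ->
  (kappa%:E < P [set t | b <= f t]%R)%E ->
  ((b - a)%:E <= obs_diam d P kappa)%E.
Proof.
move=> mf lf Pa Pb.
apply: le_trans (ereal_sup_ubound _); last by exists f.
apply: le_ereal_inf_tmp => _ [A [mA PA] <-].
have mfA : measurable (f @^-1` A) by rewrite -[X in measurable X]setTI; exact: mf.
have [t [At ta]] := probability_meet mfA (measurable_sublevel a mf) PA Pa.
have [u [Au ub]] := probability_meet mfA (measurable_superlevel b mf) PA Pb.
have := diam_ge (fun a b : R => `|a - b|) Au At; apply: le_trans.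
rewrite lee_fin (le_trans _ (ler_norm _))//.
by move: ta ub => /= ta ub; exact: lerB.
Qed.

(** Balls of radius [delta] are singletons, so every set is open. *)
Lemma measurable_separated {R : realType} (X : mmSpace R) (delta : R) :
  0 < delta -> (forall x y : X, x <> y -> delta <= mdist x y) ->
  forall A : set (borel X), measurable A.
Proof.
move=> d0 sepX A; apply: sub_sigma_algebra => /=.
rewrite openE => x Ax; apply/nbhs_ballP; exists delta => //= y.
rewrite ballEmdist/= => xy; have [<-//|/eqP/sepX] := eqVneq x y.
by rewrite leNgt xy.
Qed.

Lemma lp_sum_lipschitz {R : realType} (X : mmSpace R) (delta D p : R) (x : X)
    (n : nat) (t u : n.-tuple (borel X)) :
  0 < delta -> (forall x y : X, x <> y -> delta <= mdist x y) ->
  0 < D -> (forall x y : X, mdist x y <= D) -> 1 < p ->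
  (delta / D) `^ (p - 1) / p *
    `|\sum_(i < n) mm_dist x (tnth t i) `^ p -
      \sum_(i < n) mm_dist x (tnth u i) `^ p| <=
  \sum_(i < n) mm_dist (tnth t i) (tnth u i) `^ p.
Proof.
move=> d0 sepX D0 dD p1.
have p0 : 0 < p by exact: lt_trans p1.
have pm0 : 0 < p - 1 by rewrite subr_gt0.
rewrite -sumrB; apply: (@le_trans _ _ ((delta / D) `^ (p - 1) / p *
    \sum_(i < n) `|mm_dist x (tnth t i) `^ p - mm_dist x (tnth u i) `^ p|)).
  by rewrite ler_wpM2l ?ler_norm_sum// divr_ge0 ?powR_ge0// ltW.
rewrite mulr_sumr; apply: ler_sum => i _.
set y := tnth t i; set z := tnth u i; rewrite /mm_dist.
have yz : `|mdist x y - mdist x z| <= mdist y z :> R.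
  have h1 := metric_triangle x z y; have h2 := metric_triangle x y z.
  by rewrite [mdist z y]metric_sym in h1; rewrite ler_norml; apply/andP; split; lra.
have bd (w : X) : 0 <= mdist x w <= D by rewrite mdist_ge0 dD.
have := powR_sub_le p1 (bd y) (bd z).
move=> /(ler_wpM2l (_ : 0 <= (delta / D) `^ (p - 1) / p)) => /(_ _) H.
apply: le_trans (H _) _; first by rewrite divr_ge0 ?powR_ge0// ltW.
have -> : (delta / D) `^ (p - 1) / p * (p * D `^ (p - 1) * `|mdist x y - mdist x z|)
    = delta `^ (p - 1) * `|mdist x y - mdist x z|.
  have Dn0 : D != 0 by rewrite gt_eqF.
  have -> : delta `^ (p - 1) = (delta / D) `^ (p - 1) * D `^ (p - 1).
    by rewrite -powRM ?divfK// ?divr_ge0// ltW.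
  by field; rewrite gt_eqF.
apply: (@le_trans _ _ (delta `^ (p - 1) * mdist y z)).
  by rewrite ler_wpM2l ?powR_ge0.
(* Separation turns the linear bound into one by the [p]-th power: for [y != z], [delta ^ (p - 1)]
   is at most [mdist y z ^ (p - 1)]. *)
have [<-|/eqP/sepX dyz] := eqVneq y z; first by rewrite mdistxx mulr0 powR_ge0.
rewrite -(mulr_powRB1 (mdist_ge0 _ _) p0) mulrC ler_wpM2l ?mdist_ge0//.
by apply: ge0_ler_powR; rewrite ?nnegrE ?mdist_ge0 ?(ltW pm0) ?(ltW d0).
Qed.

Lemma obs_diam_power_ge {R : realType} (X : mmSpace R)
    (delta D p kappa c w : R) (x : X) (n : nat) :
  0 < delta -> (forall x y : X, x <> y -> delta <= mdist x y) ->
  0 < D -> (forall x y : X, mdist x y <= D) -> 1 < p -> 0 <= w ->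
  (kappa%:E < tensor_power (mm_measure X) n
    [set t | \sum_(i < n) mm_dist x (tnth t i) `^ p <= c - w]%R)%E ->
  (kappa%:E < tensor_power (mm_measure X) n
    [set t | c + w <= \sum_(i < n) mm_dist x (tnth t i) `^ p]%R)%E ->
  (((2 * w * ((delta / D) `^ (p - 1) / p)) `^ p^-1)%:E <=
    obs_diam_power X p n kappa)%E.
Proof.
move=> d0 sepX D0 dD p1 w0 Pa Pb.
have p0 : 0 < p by exact: lt_trans p1.
set L := (delta / D) `^ (p - 1) / p.
have L0 : 0 <= L by rewrite divr_ge0 ?powR_ge0// ltW.
pose S (t : n.-tuple (borel X)) := \sum_(i < n) mm_dist x (tnth t i) `^ p.
(* The positive part starts at [c - w], so [f] vanishes on the lower event and is at least the
   [p]-th root of [2 * w * L] on the upper one. *)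
pose f t := Num.max 0 (L * (S t - (c - w))) `^ p^-1.
have pV : 0 < p^-1 <= 1 by rewrite invr_gt0 p0 invf_le1// ltW.
have mY : measurable_fun setT (fun y : borel X => mm_dist x y `^ p).
  by move=> _ A _; exact: measurable_separated d0 sepX _.
have mS : measurable_fun setT S by exact: measurable_tuple_sum mY.
have mf : measurable_fun setT f.
  apply: (measurableT_comp (f := fun y : R => y `^ p^-1)) => //.
  apply: measurable_maxr => //; apply: measurable_funM => //.
  exact: measurable_funB.
have lf : lipschitz1 (lp_dist (@mm_dist R X) p (n := n)) f.
  move=> t u; apply: le_trans (powR_max0_lipschitz _ _ pV) _.
  rewrite /lp_dist; have /andP[pV0 _] := pV.
  have sum0 : 0 <= \sum_(i < n) mm_dist (tnth t i) (tnth u i) `^ p.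
    by apply: sumr_ge0 => i _; exact: powR_ge0.
  apply: ge0_ler_powR; rewrite ?nnegrE ?(ltW pV0)//.
  have -> : L * (S t - (c - w)) - L * (S u - (c - w)) = L * (S t - S u) by ring.
  rewrite normrM ger0_norm//.
  exact: lp_sum_lipschitz d0 sepX D0 dD p1.
rewrite -[_ `^ _]subr0; apply: (obs_diam_ge mf lf).
- apply: lt_le_trans Pa _; apply: le_measure.
  + by rewrite inE; exact: measurable_sublevel mS.
  + by rewrite inE; exact: measurable_sublevel mf.
  + move=> t /= St; rewrite /f max_l ?powR0 ?invr_eq0 ?gt_eqF//.
    by rewrite mulr_ge0_le0// subr_le0.
- apply: lt_le_trans Pb _; apply: le_measure.
  + by rewrite inE; exact: measurable_superlevel mS.
  + by rewrite inE; exact: measurable_superlevel mf.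
  + move=> t /= St; have /andP[pV0 _] := pV.
    have wL : 2 * w * L <= L * (S t - (c - w)).
      by rewrite mulrC ler_wpM2l//; rewrite /S; lra.
    have wL0 : 0 <= 2 * w * L by rewrite mulr_ge0// mulr_ge0.
    apply: ge0_ler_powR; rewrite ?nnegrE ?(ltW pV0)//.
      by rewrite le_max lexx.
    by rewrite le_max wL orbT.
Qed.

(** * The lower bound *)

(** The bound for one base point [x] and one [s < r]; the supremum over [x] and the limit of [s] to
    [r] are left to the theorem. *)
Lemma obs_diam_liminf_ge {R : realType} (X : mmSpace R)
    (delta D p r s : R) (x : X) :
  0 < delta -> (forall x y : X, x <> y -> delta <= mdist x y) ->
  0 < D -> (forall x y : X, mdist x y <= D) -> 1 < p -> 0 < s -> s < r ->
  let V := fine 'V_(mm_measure X)[fun y => mm_dist x y `^ p] in 0 < V ->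
  (((2 * s * Num.sqrt V / p) `^ p^-1 * (delta / D) `^ (1 - p^-1))%:E <=
   limn_einf (fun n : nat =>
     obs_diam_power X p n (Phi r) * ((n%:R `^ (2 * p)^-1)^-1)%:E))%E.
Proof.
move=> d0 sepX D0 dD p1 s0 sr V V0.
have p0 : 0 < p by exact: lt_trans p1.
set P := mm_measure X in V V0 *.
have mfun_all (f : borel X -> R) : measurable_fun setT f.
  by move=> _ A _; exact: measurable_separated d0 sepX _.
pose f (y : borel X) := mm_dist x y `^ p; pose m := \int[P]_y f y.
have f0 y : 0 <= f y by exact: powR_ge0.
have fD y : `|f y| <= D `^ p.
  rewrite ger0_norm//; apply: ge0_ler_powR; rewrite ?nnegrE ?(ltW p0) ?(ltW D0)//.
    exact: mdist_ge0.
  exact: dD.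
have intf := bounded_integrable P (mfun_all f) fD.
have VE : V = \int[P]_y ((f y - m) ^+ 2).
  rewrite /V /variance covariance.unlock expectation.unlock /Rintegral.
  by congr fine; apply: eq_integral => y _; rewrite expr2.
pose q := Num.sqrt V; have q0 : 0 < q by rewrite sqrtr_gt0.
have q2 : q ^+ 2 = V by rewrite sqr_sqrtr// ltW.
pose Y (y : borel X) := (f y - m) / q.
have fmB y : `|f y - m| <= D `^ p + `|m|.
  by rewrite (le_trans (ler_normB _ _))// lerD2r.
have YB y : `|Y y| <= (D `^ p + `|m|) / q.
  by rewrite normrM [`|q^-1|]ger0_norm ?invr_ge0 ?(ltW q0)// ler_wpM2r ?invr_ge0 ?(ltW q0).
have intc : P.-integrable setT (EFin \o (fun=> - m)).
  by apply: (@bounded_integrable _ _ _ _ _ `|- m|) => //.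
have intfm := bounded_integrable P (mfun_all (fun y => f y - m)) fmB.
have Efm : \int[P]_y (f y - m) = 0.
  rewrite (RintegralD measurableT intf intc).
  have -> : \int[P]_(_ in setT) (- m) = - m.
    transitivity (- m * fine (P setT)); first exact: Rintegral_cst.
    by rewrite probability_setT mulr1.
  by rewrite /m subrr.
have EY : \int[P]_y Y y = 0.
  by rewrite (RintegralZr q^-1 measurableT intfm) Efm mul0r.
have intfm2 : P.-integrable setT (EFin \o (fun y => (f y - m) ^+ 2)).
  apply: (@bounded_integrable _ _ _ P _ ((D `^ p + `|m|) ^+ 2)) => // y.
  by rewrite normrX lerXn2r ?nnegrE// (le_trans _ (fmB y)).
have EY2 : \int[P]_y (Y y ^+ 2) = 1.
  transitivity (\int[P]_y ((f y - m) ^+ 2 * (q ^+ 2)^-1)).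
    by apply: eq_Rintegral => y _; rewrite exprMn exprVn.
  by rewrite (RintegralZr _ measurableT intfm2) -VE q2 divff// gt_eqF.
have NYB y : `|- Y y| <= (D `^ p + `|m|) / q by rewrite normrN.
have intY := bounded_integrable P (mfun_all Y) YB.
have ENY : \int[P]_y (- Y y) = 0.
  under eq_Rintegral do rewrite -mulN1r.
  by rewrite (RintegralZl _ measurableT intY) EY mulr0.
have ENY2 : \int[P]_y ((- Y y) ^+ 2) = 1.
  by under eq_Rintegral do rewrite sqrrN.
apply: limn_einf_ge; near=> n.
have n0 : (0 < n)%N by near: n; exists 1%N.
have nR0 : 0 < n%:R :> R by rewrite ltr0n.
(* [s] standard deviations of the sum of the [f], whose mean is [n * m]; the tails of [Y] and [- Y]
   give the upper and the lower event. *)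
pose w := s * Num.sqrt n%:R * q.
have w0 : 0 <= w by rewrite !mulr_ge0 ?sqrtr_ge0// ltW.
have SE (t : n.-tuple (borel X)) :
    \sum_(i < n) Y (tnth t i) = (\sum_(i < n) f (tnth t i) - n%:R * m) / q.
  by rewrite -mulr_suml sumrB sumr_const card_ord mulr_natl.
have T1 : ((Phi r)%:E < tensor_power P n
    [set t | s * Num.sqrt n%:R <= \sum_(i < n) Y (tnth t i)]%R)%E.
  by near: n; exact: tail_tensor_power (mfun_all Y) YB EY EY2 s0 sr.
have T2 : ((Phi r)%:E < tensor_power P n
    [set t | s * Num.sqrt n%:R <= \sum_(i < n) - Y (tnth t i)]%R)%E.
  near: n.
  exact: (tail_tensor_power (mfun_all (fun y => - Y y)) NYB ENY ENY2 s0 sr).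
have E1 (t : n.-tuple (borel X)) : (s * Num.sqrt n%:R <= \sum_(i < n) Y (tnth t i))
    = (n%:R * m + w <= \sum_(i < n) f (tnth t i)).
  by rewrite SE ler_pdivlMr// -/w lerBrDl.
have E2 (t : n.-tuple (borel X)) : (s * Num.sqrt n%:R <= \sum_(i < n) - Y (tnth t i))
    = (\sum_(i < n) f (tnth t i) <= n%:R * m - w).
  by rewrite sumrN SE -mulNr ler_pdivlMr// -/w opprB lerBrDl lerBrDr addrC.
have {}T1 : ((Phi r)%:E < tensor_power P n
    [set t | n%:R * m + w <= \sum_(i < n) f (tnth t i)]%R)%E.
  by apply: lt_le_trans T1 _; rewrite le_eqVlt; apply/orP; left; apply/eqP;
    congr (tensor_power P n _); apply/seteqP; split=> t /=; rewrite E1.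
have {}T2 : ((Phi r)%:E < tensor_power P n
    [set t | \sum_(i < n) f (tnth t i) <= n%:R * m - w]%R)%E.
  by apply: lt_le_trans T2 _; rewrite le_eqVlt; apply/orP; left; apply/eqP;
    congr (tensor_power P n _); apply/seteqP; split=> t /=; rewrite E2.
have := obs_diam_power_ge d0 sepX D0 dD p1 w0 T2 T1.
set O := obs_diam_power _ _ _ _ => HO.
have nV : 0 < n%:R `^ (2 * p)^-1 :> R by exact: powR_gt0.
have nVK : ((n%:R `^ (2 * p)^-1)%:E * ((n%:R `^ (2 * p)^-1)^-1)%:E = 1)%E.
  by rewrite -EFinM divff// gt_eqF.
rewrite -[leLHS]mule1 -nVK.
rewrite muleA lee_wpmul2r ?lee_fin ?invr_ge0 ?(ltW nV)//.
apply: le_trans HO; rewrite -EFinM lee_fin le_eqVlt; apply/orP; left; apply/eqP.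
have dD0 : 0 <= delta / D by rewrite divr_ge0// ltW.
have a0 : 0 <= 2 * s * q / p by rewrite divr_ge0 ?mulr_ge0 ?(ltW s0) ?(ltW q0) ?(ltW p0).
(* The [p]-th root of [sqrt n] is [n ^ (1 / (2 * p))], the normalisation, and
   [(p - 1) / p = 1 - 1 / p]. *)
have -> : 2 * w * ((delta / D) `^ (p - 1) / p) =
    2 * s * q / p * (delta / D) `^ (p - 1) * Num.sqrt n%:R.
  by rewrite /w; ring.
have bp0 : 0 <= (delta / D) `^ (p - 1) by exact: powR_ge0.
set a := 2 * s * q / p in a0 *; set b := (delta / D) `^ (p - 1) in bp0 *.
rewrite [in RHS](powRM _ (mulr_ge0 a0 bp0) (sqrtr_ge0 _)) [in RHS](powRM _ a0 bp0).
rewrite /b -powRrM mulrBl mul1r divff ?gt_eqF//.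
by rewrite -powR12_sqrt ?ler0n// -powRrM invfM.
Unshelve. all: by end_near. Qed.

(* For kappa > 1/2 the number Phi_inv kappa is negative and its real power is
   not defined; there the base is replaced by 0 (the library's power of a
   negative base is 1, which is not meant).  Both [fine] are applied to finite
   quantities, the diameter of X being finite. *)
Theorem theorem1p2 (R : realType) (X : mmSpace R) (delta kappa p : R) :
  nontrivial X ->
  (mm_diam X < +oo)%E ->
  0 < delta ->
  (forall x y : X, x <> y -> delta <= mdist x y) ->
  0 < kappa < 1 ->
  1 < p ->
  (limn_einf (fun n : nat =>
      obs_diam_power X p n kappa * ((n%:R `^ (2 * p)^-1)^-1)%:E)
   >= ((Num.max 0 (2 * Phi_inv kappa * Num.sqrt (fine (V_sup X p)) / p)) `^ p^-1
       * (delta / fine (mm_diam X)) `^ (1 - p^-1))%:E)%E.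
Proof.
move=> _ Dfin d0 sepX kappa01 p1.
have p0 : 0 < p by exact: lt_trans p1.
have D0 : 0 <= fine (mm_diam X) by rewrite fine_ge0// diam_ge0.
have dD (x y : X) : mdist x y <= fine (mm_diam X).
  have Dnum : mm_diam X \is a fin_num by rewrite ge0_fin_numE// diam_ge0.
  by rewrite -lee_fin fineK//; exact: (@diam_ge _ _ (@mm_dist R X) setT x y I I).
set D := fine _ in D0 dD *; set r := Phi_inv kappa; set v := fine (V_sup X p).
set a := 2 * r * Num.sqrt v / p.
have obs0 n : (0 <= obs_diam_power X p n kappa * ((n%:R `^ (2 * p)^-1)^-1)%:E)%E.
  rewrite mule_ge0 ?lee_fin ?invr_ge0 ?powR_ge0//.
  by apply: obs_diam_ge0 => x y; exact: powR_ge0.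
(* For [a <= 0], and below for [D = 0] where [delta / D] is 0, the claimed bound is 0. *)
have [a0|a0] := leP a 0.
  rewrite powR0 ?invr_eq0 ?gt_eqF// mul0r.
  by apply: limn_einf_ge; exact: nearW.
have [D00|Dn0] := eqVneq D 0.
  rewrite D00 invr0 mulr0 [0 `^ _]powR0 ?mulr0; last first.
    by rewrite subr_eq0 eq_sym invr_eq1 gt_eqF.
  by apply: limn_einf_ge; exact: nearW.
have {Dn0}D0 : 0 < D by rewrite lt_neqAle eq_sym Dn0.
have v0 : 0 < v.
  rewrite ltNge; apply/negP => v0; move: a0.
  by rewrite /a ler0_sqrtr// mulr0 mul0r ltxx.
have r0 : 0 < r.
  rewrite ltNge; apply/negP => r0; move: a0; rewrite ltNge => /negP; apply.
  rewrite /a mulr_le0_ge0 ?invr_ge0 ?(ltW p0)// mulr_le0_ge0 ?sqrtr_ge0//.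
  by rewrite mulr_ge0_le0.
(* As [r > 0], it is not the default value 0 of [xget], hence a true preimage. Likewise [v > 0]
   excludes an infinite supremum, whose [fine] is 0. *)
have rE : Phi r = kappa.
  move: r0; rewrite /r /Phi_inv; case: xgetP => [y _ //|_]; by rewrite ltxx.
have Vsup : V_sup X p = v%:E.
  rewrite /v fineK// fin_numE; apply/andP; split; apply/eqP => E;
  by move: v0; rewrite /v E/= ltxx.
(* It suffices to reach every fraction [eta] of the bound. Under the [p]-th root the allowed loss is
   [eta ^ p], split evenly: a factor [th] for replacing [r] by [th * r], and a factor [th] for
   replacing [sqrt v] by the standard deviation at a nearly optimal [x]. *)
apply/lee_mul01Pr => [|eta /andP[eta0 eta1]].
  by rewrite lee_fin mulr_ge0// powR_ge0.
have h0 : 0 < eta `^ p by exact: powR_gt0.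
have h1 : eta `^ p < 1.
  rewrite -[ltRHS](_ : 1 `^ p = 1); last by rewrite powR1.
  by rewrite gt0_ltr_powR ?nnegrE// ltW.
pose th := Num.sqrt (eta `^ p).
have th2 : th ^+ 2 = eta `^ p by rewrite sqr_sqrtr// ltW.
have th0 : 0 < th by rewrite sqrtr_gt0.
have th1 : th < 1 by rewrite -[ltRHS]sqrtr1 ltr_sqrt.
have /ereal_sup_gt[_ [x _ <-] vx] : (((eta `^ p) * v)%:E < V_sup X p)%E.
  by rewrite Vsup lte_fin gtr_pMl.
have vfin : 'V_(mm_measure X)[fun y => mm_dist x y `^ p] \is a fin_num.
  rewrite ge0_fin_numE ?variance_ge0//; apply: le_lt_trans (ltry v).
  by rewrite -Vsup; apply: ereal_sup_ubound; exists x.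
rewrite -(fineK vfin) lte_fin in vx.
set V := fine _ in vx.
have V0 : 0 < V by apply: lt_trans vx; rewrite mulr_gt0.
have sV : th * Num.sqrt v <= Num.sqrt V.
  by rewrite -sqrtrM ?(ltW h0)// ler_wsqrtr// ltW.
have s0 : 0 < th * r by rewrite mulr_gt0.
have sr : th * r < r by rewrite gtr_pMl.
have := obs_diam_liminf_ge d0 sepX D0 dD p1 s0 sr V0.
rewrite rE; apply: le_trans; rewrite -EFinM lee_fin mulrA ler_wpM2r ?powR_ge0//.
have -> : eta * a `^ p^-1 = (eta `^ p * a) `^ p^-1.
  by rewrite powRM ?(ltW h0) ?(ltW a0)// -powRrM divff ?gt_eqF// powRr1// ltW.
apply: ge0_ler_powR; rewrite ?nnegrE ?invr_ge0 ?(ltW p0)//.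
- by rewrite mulr_ge0 ?(ltW h0) ?(ltW a0).
- by rewrite divr_ge0 ?(ltW p0)// mulr_ge0 ?sqrtr_ge0// mulr_ge0// ltW.
have -> : eta `^ p * a = 2 * (th * r) * (th * Num.sqrt v) / p.
  by rewrite -th2 /a; ring.
rewrite ler_wpM2r ?invr_ge0 ?(ltW p0)// ler_wpM2l//.
by rewrite mulr_ge0// ltW.
Qed.
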